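(* Consider the problem of finding a stationary policy $\pi\in\Pi$ such that $$ \lim_{T\to\infty}\mathbf{E}\left(\frac1T\sum_{k=0}^{T-1}r^j(s_k,\pi(s_k))\right)\ge0\quad\text{for } j=1,\dots,J. \qquad (\ast) $$ Suppose that there exists a state $s^*\in S$ which is recurrent for every stationary policy $\pi$ played by the agent, and that the absolute values of the reward functions $r^1,\dots,r^J$ are bounded by some constant $c$ known to the agent. Let $\pi^\star$ be an optimal policy in the zero-sum game $$ v=\max_{\pi\in\Pi}\min_{j\in[J]}\lim_{T\to\infty}\mathbf{E}\left(\frac1T\sum_{k=0}^{T-1}r^j(s_k,\pi(s_k))\right). $$ Then $\pi^\star$ is a solution to $(\ast)$ if and only if $v\ge0$.
   Context: $(S,A,P)$ is a Markov decision process with finite state set $S$, finite action set $A$, and transition function $P:S\times A\times S\to[0,1]$, $P(s,a,s_+)=\mathbf{Pr}(s_+\mid s,a)$, $\sum_{s_+\in S}P(s,a,s_+)=1$. $r^j:S\times A\to\mathbb{R}$, $j=1,\dots,J$, are reward functions and $[J]=\{1,\dots,J\}$. $\Pi$ is the set of (stationary, possibly randomized) policies mapping each state $s$ to a probability distribution over $A$; $\pi(s)=a$ with probability $\mathbf{Pr}(a\mid s)$. The expectation is over the randomness of the policy and of the transitions; under the recurrent state assumption the average rewards do not depend on the initial state. An optimal policy in the game is one attaining the maximum over $\Pi$ of the minimum over $j$. *)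

(* Defs.v *)
From mathcomp Require Import all_boot all_order all_algebra.
From mathcomp Require Import all_classical all_reals all_analysis.

Set Implicit Arguments.
Unset Strict Implicit.
Unset Printing Implicit Defensive.

Import Order.TTheory GRing.Theory Num.Theory.
Import numFieldNormedType.Exports.

Local Open Scope classical_set_scope.
Local Open Scope ring_scope.

Definition is_distribution (R : realType) (X : finType) (mu : X -> R) : Prop :=
  (forall x, 0 <= mu x) /\ \sum_(x : X) mu x = 1.

(* [P s a s'] is the probability of moving from [s] to [s'] under action [a]. *)
Definition is_transition (R : realType) (S A : finType)
    (P : S -> A -> S -> R) : Prop :=
  forall s a, is_distribution (P s a).

(* Stationary randomized policies: [pi s a] is the probability that the action
   played in state [s] is [a]. *)
Definition is_policy (R : realType) (S A : finType) (pi : S -> A -> R) : Prop :=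
  forall s, is_distribution (pi s).

(* Probability that the trajectory (s_0, a_0), (s_1, a_1), ... begins with [w]
   when s_0 has law [mu], a_k has law [pi s_k] and s_(k+1) has law
   [P s_k a_k]. *)
Fixpoint traj_prob (R : realType) (S A : finType) (P : S -> A -> S -> R)
    (pi : S -> A -> R) (mu : S -> R) (w : seq (S * A)) : R :=
  if w is (s, a) :: w' then mu s * pi s a * traj_prob P pi (P s a) w' else 1.

(* Expectation of a function [f] of (s_0, a_0), ..., (s_(T-1), a_(T-1)), for the
   chain started at [s0]; every expectation and probability used below concerns
   a quantity determined by finitely many steps. *)
Definition traj_expect (R : realType) (S A : finType) (P : S -> A -> S -> R)
    (pi : S -> A -> R) (s0 : S) (T : nat) (f : T.-tuple (S * A) -> R) : R :=
  \sum_(w : T.-tuple (S * A)) traj_prob P pi (fun s => (s == s0)%:R) w * f w.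

(* The realized action [a_k] is what [pi(s_k)] denotes for a randomized
   policy. *)
Definition mean_reward (R : realType) (S A : finType) (P : S -> A -> S -> R)
    (pi : S -> A -> R) (s0 : S) (r : S -> A -> R) (T : nat) : R :=
  traj_expect P pi s0 (fun w : T.-tuple (S * A) =>
    T%:R^-1 * \sum_(k < T) r (tnth w k).1 (tnth w k).2).

Definition avg_reward (R : realType) (S A : finType) (P : S -> A -> S -> R)
    (pi : S -> A -> R) (s0 : S) (r : S -> A -> R) : R :=
  limn (mean_reward P pi s0 r).

(* Pr (s_k = s for some k with 1 <= k <= n | s_0 = s) *)
Definition return_prob (R : realType) (S A : finType) (P : S -> A -> S -> R)
    (pi : S -> A -> R) (s : S) (n : nat) : R :=
  traj_expect P pi s (fun w : n.+1.-tuple (S * A) =>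
    (has (fun sa => sa.1 == s) (behead w))%:R).

(* Started at [s], the chain returns to [s] with probability one: the
   probabilities of the increasing events "return by time n" tend to 1. Nothing is required of
   the other states. *)
Definition recurrent (R : realType) (S A : finType) (P : S -> A -> S -> R)
    (pi : S -> A -> R) (s : S) : Prop :=
  return_prob P pi s n @[n --> \oo] --> (1 : R).

(* As [limn] is a total operator, the existence of the limits is required
   explicitly. *)
Definition solves (R : realType) (S A : finType) (P : S -> A -> S -> R)
    (J : nat) (r : 'I_J -> S -> A -> R) (s0 : S) (pi : S -> A -> R) : Prop :=
  is_policy pi /\
  forall j : 'I_J, cvgn (mean_reward P pi s0 (r j)) /\
                   0 <= avg_reward P pi s0 (r j).

(* The minimum is over a nonempty family, hence the index type ['I_J.+1]; the
   default value of the iterated minimum is one of its terms. *)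
Definition worst_avg_reward (R : realType) (S A : finType)
    (P : S -> A -> S -> R) (J : nat) (r : 'I_J.+1 -> S -> A -> R) (s0 : S)
    (pi : S -> A -> R) : R :=
  \big[Num.min/avg_reward P pi s0 (r ord0)]_(j < J.+1)
    avg_reward P pi s0 (r j).

Definition is_maximum (R : realType) (X : set R) (v : R) : Prop :=
  X v /\ ubound X v.

Definition is_game_value (R : realType) (S A : finType)
    (P : S -> A -> S -> R) (J : nat) (r : 'I_J.+1 -> S -> A -> R) (s0 : S)
    (v : R) : Prop :=
  is_maximum [set worst_avg_reward P r s0 pi | pi in @is_policy R S A] v.

(* [pi] attains the maximum [v]. *)
Definition is_optimal (R : realType) (S A : finType)
    (P : S -> A -> S -> R) (J : nat) (r : 'I_J.+1 -> S -> A -> R) (s0 : S)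
    (v : R) (pi : S -> A -> R) : Prop :=
  is_policy pi /\ worst_avg_reward P r s0 pi = v.

(* Main.v *)
Require Import Defs.
From HB Require Import structures.
From mathcomp Require Import all_boot all_order all_algebra.
From mathcomp Require Import all_classical all_reals all_analysis.

Import Order.TTheory GRing.Theory Num.Theory.
Import numFieldNormedType.Exports.

Local Open Scope classical_set_scope.
Local Open Scope ring_scope.

(** An optimal policy has worst average reward [v], and a minimum of finitely
    many numbers is nonnegative exactly when each of them is, so the equivalence
    is immediate once the averages in [solves] are known to converge.

    That convergence holds for every stationary policy.  Let [Q] be the
    transition operator of the Markov chain induced by the policy, acting on
    real functions on the states, and let [g] be the expected one-step reward.
    The mean reward over [T] steps from [s0] is the value at [s0] of
    [T^-1 * \sum_(k < T) Q^k g] ([mean_rewardE]).  Such Cesaro means converge for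
    every linear [Q] with bounded orbits on a finite-dimensional function space
    ([mean_ergodic]).  Indeed, if [y = x - Q x] is fixed by [Q], then telescoping
    gives [T y = x - Q^T x], which is bounded in [T], so [y = 0].  Hence the
    kernel and the image of [1 - Q] meet trivially and, by rank-nullity, span
    the whole space.  Writing [g = y + (z - Q z)] with [Q y = y], the Cesaro
    means of [g] are [y + T^-1 (z - Q^T z)] for [T > 0] and tend to [y]. *)

(** * Mean ergodic theorem in finite dimension *)

(** If [ker f] and [im f] meet trivially, then they span the space. *)
Lemma lker_limg_decomp (K : fieldType) (V : vectType K) (f : 'End(V))
    (hf : forall x, f (f x) = 0 -> f x = 0) (x : V) :
  exists y z, f y = 0 /\ x = y + f z.
Proof.
have cap0 : (lker f :&: limg f = 0)%VS.
  apply/eqP; rewrite -subv0; apply/subvP => u /memv_capP[].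
  rewrite memv_ker memv0 => /eqP fu0 /memv_imgP[w _ uE].
  by rewrite uE hf // -uE.
have /eqP sumT : (lker f + limg f == fullv)%VS.
  by rewrite eqEdim subvf dimv_disjoint_sum // -(limg_ker_dim f fullv) capfv /=.
have : x \in (lker f + limg f)%VS by rewrite sumT memvf.
case/memv_addP => y; rewrite memv_ker => /eqP fy0 [_ /memv_imgP[z _ ->] ->].
by exists y, z.
Qed.

Lemma cvg_bounded_div (R : realType) (u : nat -> R) (M : R)
    (hu : forall n, `|u n| <= M) :
  n%:R^-1 * u n @[n --> \oo] --> (0 : R).
Proof.
have h : M * n%:R^-1 @[n --> \oo] --> (0 : R).
  (* Shifting the index turns [n^-1] into the harmonic sequence [1 / (n + 1)]. *)
  rewrite -(cvg_shiftS (fun n => M * n%:R^-1)) /=.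
  have : M * harmonic n @[n --> \oo] --> M * 0.
    exact: cvgM (cvg_cst _) cvg_harmonic.
  by rewrite mulr0.
have h' : - (M * n%:R^-1) @[n --> \oo] --> (0 : R).
  rewrite -oppr0; exact: cvgN.
apply: squeeze_cvgr h' h; apply: nearW => n.
by rewrite -ler_norml normrM [leRHS]mulrC ger0_norm ?invr_ge0 // ler_wpM2l ?invr_ge0.
Qed.

Lemma sum_iter_telescope (R : pzRingType) (V : lmodType R)
    (f : {linear V -> V}) (z : V) (n : nat) :
  \sum_(k < n) iter k f (z - f z) = z - iter n f z.
Proof.
have iterB k : iter k f (z - f z) = iter k f z - iter k.+1 f z.
  elim: k => // k IH; by rewrite iterS IH linearB.
elim: n => [|n IH]; first by rewrite big_ord0 subrr.
by rewrite big_ord_recr /= IH iterB addrA subrK.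
Qed.

Lemma sum_iter_fix (V : nmodType) (f : V -> V) (y : V) (fy : f y = y)
    (n : nat) : \sum_(k < n) iter k f y = y *+ n.
Proof.
rewrite (eq_bigr (fun=> y)) ?sumr_const ?card_ord // => k _.
by elim: (k : nat) => //= m ->.
Qed.

(** Von Neumann's mean ergodic theorem for a linear map with bounded orbits on
    the functions on a finite set. *)
Lemma mean_ergodic (R : realType) (S : finType)
    (f : {linear {ffun S -> R^o} -> {ffun S -> R^o}})
    (hb : forall x, exists M : R, forall n s, `|iter n f x s| <= M)
    (g : {ffun S -> R^o}) (s : S) :
  cvgn (fun n => n%:R^-1 * \sum_(k < n) iter k f g s : R).
Proof.
have small z t : n%:R^-1 * (z - iter n f z) t @[n --> \oo] --> (0 : R).
  have [M hM] := hb z; apply: (@cvg_bounded_div _ _ (M + M)) => n.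
  rewrite !ffunE; apply: le_trans (ler_normB _ _) _.
  by rewrite lerD // (hM 0).
pose F : 'End({ffun S -> R^o}) := (\1 - linfun f)%VF.
have FE x : F x = x - f x by rewrite /F add_lfunE opp_lfunE id_lfunE lfunE.
have hF x : F (F x) = 0 -> F x = 0.
  (* [F x] is fixed by [f], hence equals its own Cesaro means, which tend to 0. *)
  rewrite (FE (F x)) => /eqP; rewrite subr_eq0 eq_sym => /eqP fix_y.
  apply/ffunP => t; rewrite [RHS]ffunE.
  have h := small x t; apply: (cvg_unique _ _ h) => //.
  apply: cvg_near_cst; near=> n.
  rewrite -sum_iter_telescope -FE sum_iter_fix // ffunMnE -[X in _ * X = _]mulr_natl.
  rewrite mulrA mulVf ?mul1r //.
  by rewrite pnatr_eq0 -lt0n; near: n; exact: nbhs_infty_gt.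
have [y [z [Fy0 ->]]] := lker_limg_decomp _ _ F hF g.
have fy : f y = y by apply/eqP; rewrite eq_sym -subr_eq0 -FE Fy0.
have iterD k a b : iter k f (a + b) = iter k f a + iter k f b.
  by elim: k => //= k ->; rewrite linearD.
apply/cvg_ex; exists (y s + 0).
rewrite FE; apply: (cvg_trans _ (cvgD (cvg_cst (y s)) (small z s))).
apply: near_eq_cvg; near=> n.
have -> : \sum_(k < n) iter k f (y + (z - f z)) s = y s *+ n + (z - iter n f z) s.
  rewrite -sum_iter_telescope -ffunMnE -(sum_iter_fix _ f y fy) !sum_ffunE.
  by rewrite -big_split /=; apply: eq_bigr => k _; rewrite iterD ffunE.
rewrite mulrDr -[y s *+ n]mulr_natl mulrA mulVf ?mul1r //.
by rewrite pnatr_eq0 -lt0n; near: n; exact: nbhs_infty_gt.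
Unshelve. all: by end_near. Qed.

(** * The transition operator of a stationary policy *)

(** The expectation of [x s_1] given [s_0 = s], as a function of [s].  The
    codomain [R^o] makes the functions on the states a vector space. *)
Definition trans_op (R : realType) (S A : finType) (P : S -> A -> S -> R)
    (pi : S -> A -> R) (x : {ffun S -> R^o}) : {ffun S -> R^o} :=
  [ffun s => \sum_a pi s a * \sum_t P s a t * x t].

Lemma trans_op_is_linear (R : realType) (S A : finType) (P : S -> A -> S -> R)
    (pi : S -> A -> R) : linear (trans_op R S A P pi).
Proof.
move=> c x y; apply/ffunP => s; rewrite !ffunE /GRing.scale /= mulr_sumr.
rewrite -big_split /=; apply: eq_bigr => a _.
rewrite mulrCA -mulrDr; congr (_ * _); rewrite mulr_sumr -big_split /=.
by apply: eq_bigr => t _; rewrite !ffunE mulrDr mulrCA.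
Qed.

HB.instance Definition _ (R : realType) (S A : finType) (P : S -> A -> S -> R)
    (pi : S -> A -> R) :=
  GRing.isLinear.Build R {ffun S -> R^o} {ffun S -> R^o} _
    (trans_op R S A P pi) (trans_op_is_linear R S A P pi).

Lemma mean_norm_le (R : realType) (X : finType) (mu x : X -> R) (M : R)
    (hmu : is_distribution mu) (hx : forall i, `|x i| <= M) :
  `|\sum_i mu i * x i| <= M.
Proof.
have [mu0 mu1] := hmu.
apply: le_trans (ler_norm_sum _ _ _) _.
rewrite -[M]mul1r -mu1 mulr_suml; apply: ler_sum => i _.
by rewrite normrM ger0_norm // ler_wpM2l.
Qed.

Lemma trans_op_bounded (R : realType) (S A : finType) (P : S -> A -> S -> R)
    (hP : is_transition P) (pi : S -> A -> R) (hpi : is_policy pi)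
    (x : {ffun S -> R^o}) :
  exists M : R, forall n s, `|iter n (trans_op R S A P pi) x s| <= M.
Proof.
(* Averages do not exceed a uniform bound, so any uniform bound on [x] serves. *)
exists (\sum_s `|x s|); elim=> [|n IH] s /=.
  by rewrite (bigD1 s) //= lerDl sumr_ge0.
rewrite ffunE; apply: mean_norm_le => // a; exact: mean_norm_le.
Qed.

(** * Expected rewards along trajectories *)

Lemma big_tuple_cons (R : nmodType) (T : finType) (n : nat)
    (F : seq T -> R) :
  \sum_(w : n.+1.-tuple T) F w = \sum_(x : T) \sum_(w : n.-tuple T) F (x :: w).
Proof.
rewrite pair_bigA /= (reindex (fun p : T * n.-tuple T => [tuple of p.1 :: p.2])) //=.
exists (fun w => (thead w, [tuple of behead w])) => [[x w] _|w _] /=.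
  by rewrite theadE; congr (_, _); apply: val_inj.
by rewrite [RHS]tuple_eta; apply: val_inj.
Qed.

Lemma big_tuple_pair_cons (R : nmodType) (X Y : finType) (n : nat)
    (F : seq (X * Y) -> R) :
  \sum_(w : n.+1.-tuple (X * Y)) F w =
  \sum_x \sum_y \sum_(w : n.-tuple (X * Y)) F ((x, y) :: w).
Proof. by rewrite big_tuple_cons [RHS]pair_bigA; apply: eq_bigr => -[]. Qed.

Lemma traj_prob_sum1 (R : realType) (S A : finType) (P : S -> A -> S -> R)
    (hP : is_transition P) (pi : S -> A -> R) (hpi : is_policy pi) (T : nat)
    (mu : S -> R) (hmu : is_distribution mu) :
  \sum_(w : T.-tuple (S * A)) traj_prob P pi mu w = 1.
Proof.
elim: T mu hmu => [|T IH] mu [mu0 mu1].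
  rewrite (eq_bigr (fun=> 1)) => [|w _]; last by rewrite tuple0.
  by rewrite sumr_const card_tuple expn0.
rewrite (big_tuple_pair_cons _ _ _ _ (traj_prob P pi mu)) /= -mu1.
apply: eq_bigr => s _; rewrite -[RHS]mulr1 -(proj2 (hpi s)) mulr_sumr.
by apply: eq_bigr => a _; rewrite -mulr_sumr IH ?mulr1.
Qed.

(** Expected one-step reward from each state. *)
Definition step_reward (R : realType) (S A : finType) (pi : S -> A -> R)
    (r : S -> A -> R) : {ffun S -> R^o} := [ffun s => \sum_a pi s a * r s a].

(** The first step of a trajectory contributes the expected one-step reward,
    because the continuations have total probability 1; the remaining steps
    form a trajectory started from the law [P s a]. *)
Lemma traj_total_reward (R : realType) (S A : finType) (P : S -> A -> S -> R)
    (hP : is_transition P) (pi : S -> A -> R) (hpi : is_policy pi)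
    (r : S -> A -> R) (T : nat) (mu : S -> R) (hmu : is_distribution mu) :
  \sum_(w : T.-tuple (S * A)) traj_prob P pi mu w * \sum_(x <- w) r x.1 x.2 =
  \sum_s mu s *
    (\sum_(k < T) iter k (trans_op R S A P pi) (step_reward R S A pi r)) s.
Proof.
elim: T mu hmu => [|T IH] mu hmu.
  rewrite big1 ?[RHS]big1 // => [s _|w _]; first by rewrite big_ord0 ffunE mulr0.
  by rewrite tuple0 big_nil mulr0.
rewrite (big_tuple_pair_cons _ _ _ _
  (fun w => traj_prob P pi mu w * \sum_(x <- w) r x.1 x.2)) /=.
apply: eq_bigr => s _.
rewrite big_ord_recl /=.
rewrite -linear_sum /= !ffunE -big_split /= mulr_sumr.
apply: eq_bigr => a _; rewrite -mulrDr mulrA -(IH (P s a)) //.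
under eq_bigr do rewrite big_cons /= -mulrA mulrDr.
rewrite -mulr_sumr big_split /= -mulr_suml traj_prob_sum1 //.
by rewrite mul1r.
Qed.

Lemma mean_rewardE (R : realType) (S A : finType) (P : S -> A -> S -> R)
    (hP : is_transition P) (pi : S -> A -> R) (hpi : is_policy pi)
    (s0 : S) (r : S -> A -> R) (T : nat) :
  mean_reward P pi s0 r T =
  T%:R^-1 *
    \sum_(k < T) iter k (trans_op R S A P pi) (step_reward R S A pi r) s0.
Proof.
have hmu : is_distribution (fun s => (s == s0)%:R : R).
  split=> [s|]; first by rewrite ler0n.
  by rewrite (bigD1 s0) //= eqxx big1 ?addr0 // => s /negPf ->.
rewrite /mean_reward /traj_expect.
under eq_bigr do rewrite mulrCA -(big_tuple _ _ _ xpredT (fun x => r x.1 x.2)).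
rewrite -mulr_sumr traj_total_reward //; congr (_ * _).
rewrite (bigD1 s0) //= eqxx mul1r [X in _ + X]big1 ?addr0 ?sum_ffunE // => s /negPf ->.
by rewrite mul0r.
Qed.

Lemma mean_reward_cvg (R : realType) (S A : finType) (P : S -> A -> S -> R)
    (hP : is_transition P) (pi : S -> A -> R) (hpi : is_policy pi)
    (s0 : S) (r : S -> A -> R) : cvgn (mean_reward P pi s0 r).
Proof.
have -> : mean_reward P pi s0 r = fun T => T%:R^-1 *
    \sum_(k < T) iter k (trans_op R S A P pi) (step_reward R S A pi r) s0.
  by apply/funext => T; apply: mean_rewardE.
apply: mean_ergodic; exact: trans_op_bounded.
Qed.

Theorem theorem5 (R : realType) (S A : finType) (P : S -> A -> S -> R)
    (hP : is_transition P)
    (J : nat) (r : 'I_J.+1 -> S -> A -> R)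
    (hrec : exists sstar : S,
        forall pi : S -> A -> R, is_policy pi -> recurrent P pi sstar)
    (c : R) (hc : forall j s a, `|r j s a| <= c)
    (s0 : S) (v : R) (hv : is_game_value P r s0 v)
    (pistar : S -> A -> R) (hopt : is_optimal P r s0 v pistar) :
  solves P r s0 pistar <-> 0 <= v.
Proof.
case: hopt => hpi <-; rewrite /worst_avg_reward; split.
  by case=> _ h; apply/bigmin_geP; split=> [|j _]; [case: (h ord0)|case: (h j)].
move=> /bigmin_geP[_ h]; split=> // j; split; last exact: h.
exact: mean_reward_cvg.
Qed.
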